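(* Let $G$ be an additive group of order $g$ and suppose there exists a harmonious $(G,K',\lambda)$-SDF. Then for every prime power $q\equiv\lambda+1\pmod{2\lambda}$ with $q>Q(\lambda,\max(K'))$ there exists an HS$(2,K,gq)$, where $K$ is the underlying set of $K'\cup\{g\}$.
   Context: For positive integers $e,n$ let $U=\sum_{h=1}^n\binom nh(e-1)^h(h-1)$ and $Q(e,n)=\frac14\bigl(U+\sqrt{U^2+4ne^{n-1}}\bigr)^2$. For a multiset $B=\{b_1,\dots,b_k\}$ in an additive group, $\Delta B=\{b_i-b_j\mid i\ne j\}$ (multiset). A $(G,K,\lambda)$-SDF is a collection $\Sigma$ of multisets in $G$ with multiset of sizes $K$ such that the multiset union of the $\Delta B$, $B\in\Sigma$, is $\lambda$ copies of all of $G$ (including $0$); it is harmonious if its block sizes sum to $\lambda$. A linear space S$(2,K,v)$ is a set of $v$ points with blocks whose sizes lie in $K$, every element of $K$ occurring as a block size, such that every pair of points lies in exactly one block; a resolution is a partition of the blocks into parallel classes each partitioning the points. An HS$(2,K,v)$ is a resolved S$(2,K,v)$ with an automorphism group acting sharply transitively on the points and transitively on the parallel classes. *)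

(* Defs.v *)
From HB Require Import structures.
From mathcomp Require Import all_boot all_order all_algebra all_fingroup.

Set Implicit Arguments.
Unset Strict Implicit.
Unset Printing Implicit Defensive.

Import GroupScope.

(* Multisets are sequences, considered up to perm_eq. *)

Section Bound.
Local Open Scope ring_scope.
Variable R : rcfType.

Definition Ubound (e n : nat) : R :=
  \sum_(1 <= h < n.+1) 'C(n, h)%:R * (e%:R - 1) ^+ h * (h%:R - 1).

Definition Qbound (e n : nat) : R :=
  1 / 4%:R *
  (Ubound e n
   + Num.sqrt (Ubound e n ^+ 2 + 4%:R * n%:R * e%:R ^+ n.-1)) ^+ 2.

End Bound.

Definition prime_power (q : nat) : Prop :=
  exists p k : nat, [/\ prime p, (0 < k)%N & q = (p ^ k)%N].

(* "Additive group" does not imply commutativity here: G is any finite group,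
   written multiplicatively as in fingroup, so that b_i - b_j is
   b_i * b_j^-1 and 0 is 1. *)
Section StrongDifferenceFamily.
Variable G : finGroupType.

(* The pairs (i, j) range over distinct positions, not distinct values, so
   repeated elements of B contribute the identity. *)
Definition Delta (B : seq G) : seq G :=
  [seq tnth (in_tuple B) ij.1 * (tnth (in_tuple B) ij.2)^-1
    | ij : 'I_(size B) * 'I_(size B) in [pred ij | ij.1 != ij.2]].

Definition SDF (K : seq nat) (lambda : nat) (Sigma : seq (seq G)) : Prop :=
  [/\ all (fun B => 0 < size B)%N Sigma,
      perm_eq (map size Sigma) K
    & forall x : G, count_mem x (flatten (map Delta Sigma)) = lambda].

Definition harmonious_SDF (K : seq nat) (lambda : nat)
    (Sigma : seq (seq G)) : Prop :=
  SDF K lambda Sigma /\ (\sum_(B <- Sigma) size B = lambda)%N.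

End StrongDifferenceFamily.

Section LinearSpace.
Variable T : finType.

(* The blocks form a multiset.  The condition on pairs excludes repeated blocks
   of size at least 2, but one-point blocks, which are allowed when 1 is in K,
   may be repeated.  K is used through membership only. *)
Definition linear_space (K : seq nat) (v : nat)
    (blocks : seq {set T}) : Prop :=
  [/\ #|T| = v,
      forall b, b \in blocks -> #|b| \in K,
      forall k, k \in K -> exists2 b, b \in blocks & #|b| = k
    & forall x y : T, x != y ->
        count (fun b : {set T} => (x \in b) && (y \in b)) blocks = 1%N].

Definition resolution (blocks : seq {set T})
    (classes : {set {set {set T}}}) : Prop :=
  (forall P, P \in classes -> partition P [set: T]) /\
  perm_eq (flatten [seq enum P | P : {set {set T}} in classes]) blocks.

Definition automorphism (blocks : seq {set T}) (a : {perm T}) : Prop :=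
  perm_eq [seq a @: (b : {set T}) | b <- blocks] blocks.

Definition sharply_transitive (A : {group {perm T}}) : Prop :=
  [transitive A, on [set: T] | 'P] /\ forall x : T, 'C_A[x | 'P] = 1.

End LinearSpace.

(* 'P^*^* is the natural action on sets of blocks; transitivity on the set of
   classes includes its invariance. *)
Definition HS_exists (K : seq nat) (v : nat) : Prop :=
  exists (T : finType) (blocks : seq {set T})
         (classes : {set {set {set T}}}) (A : {group {perm T}}),
    [/\ linear_space K v blocks,
        resolution blocks classes,
        forall a, a \in A -> automorphism blocks a,
        sharply_transitive A
      & [transitive A, on classes | 'P^*^*]].

(* Main.v *)
(* Lift the strong difference family to G x F_q: choose labels a_j for the
   positions j so that the labels represent the cosets of the subgroup H of
   index lambda of F_q^*, and so do, for every x in G, the label differences of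
   the pairs of positions of quotient x.  The H-multiples of the lifted blocks,
   translated by G, then partition G x F_q^*; adding the fibre G x {0} gives a
   parallel class, and its translates by F_q are all the classes.

   Weil's theorem on character sums is not needed to find the labels.  With
   s_y(x) the number of elements of Y in x + yH, the sum over x and all cosets
   yH of (s_y(x) - |Y| |H| / q)^2 can be computed exactly; hence for every Y
   all but few x have about |Y| / lambda elements of Y in x + yH, and the labels
   of a block can be chosen greedily, keeping the candidate sets large.  The
   losses fit below the bound Q as soon as the largest block has k >= 3
   elements, except for k = 3 and lambda = 4, which cannot occur.  If k = 2,
   counting makes G trivial and all blocks pairs, labelled y and -y. *)

Require Import Defs.
From mathcomp Require Import all_boot all_order all_algebra all_fingroup.
From mathcomp Require Import cyclic finfield.
From mathcomp Require Import zify ring lra.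

Set Implicit Arguments.
Unset Strict Implicit.
Unset Printing Implicit Defensive.

Import Order.TTheory GRing.Theory Num.Theory.

(** * Cyclotomic classes *)

Section CyclotomicClasses.
Local Open Scope ring_scope.
Variables (F : finFieldType) (e f : nat).

(* [cls x] is the discrete logarithm of [x] modulo [e]; its value at 0 is
   irrelevant. *)
Definition class_map (cls : F -> 'Z_e) : Prop :=
  [/\ {in [pred x | x != 0] &, {morph cls : x y / x * y >-> x + y}},
      forall z, #|[set x : F | (x != 0) && (cls x == z)]| = f
    & cls (-1) = (e./2)%:R].

Lemma finField_prim_root : exists w : F, (#|F|.-1).-primitive_root w.
Proof.
have q1 : (1 < #|F|)%N by exact: finNzRing_gt1.
have := @has_prim_root F #|F|.-1 (enum [pred x : F | x != 0]).
have -> : size (enum [pred x : F | x != 0]) = #|F|.-1.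
  by rewrite -cardE (cardC1 (0 : F)).
case/(_ _ _ _ _)/hasP => //.
- by case: #|F| q1 => [|[]].
- apply/allP=> x; rewrite mem_enum inE => x0; rewrite unity_rootE.
  by apply/eqP/(mulfI x0); rewrite mulr1 -exprS prednK ?expf_card // ltnW.
- exact: enum_uniq.
- by move=> w _ ?; exists w.
Qed.

(** [cls] is the discrete logarithm to a primitive root, reduced modulo [e]. All classes have the
    same size because multiplication by a power of the root permutes them. As [f] is odd, the
    exponent [e * f / 2] of -1 is congruent to [e / 2]. *)
Lemma class_map_exists : (1 < e)%N -> ~~ odd e -> odd f ->
  #|F| = (e * f).+1 -> exists cls, class_map cls.
Proof.
move=> e1 even_e odd_f cardF; have [w] := finField_prim_root.
rewrite cardF /= => prim_w; have n0 := prim_order_gt0 prim_w.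
have we := prim_expr_order prim_w.
have unitF x : x != 0 -> exists i, x = w ^+ i.
  move=> x0; have /(prim_rootP prim_w)[i ->] : x ^+ (e * f) = 1.
    by apply: (mulfI x0); rewrite mulr1 -exprS -cardF expf_card.
  by exists i.
have w0 i : w ^+ i != 0.
  apply: expf_neq0; apply: contra_eq_neq we => ->.
  by rewrite expr0n gtn_eqF // eq_sym oner_eq0.
pose lg x := if [pick i : 'I_(e * f) | w ^+ i == x] is Some i then i : nat else 0%N.
pose cls x : 'Z_e := (lg x)%:R.
have clsX i : cls (w ^+ i) = i%:R.
  rewrite /cls /lg; case: pickP => [j|/(_ (Ordinal (ltn_pmod i n0)))] /=; last first.
    by rewrite prim_expr_mod // eqxx.
  rewrite (eq_prim_root_expr prim_w) => /eqP ij.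
  rewrite -(Zp_nat_mod e1 j) -(Zp_nat_mod e1 i).
  by rewrite -(modn_dvdm j (dvdn_mulr f (dvdnn e))) ij modn_dvdm ?dvdn_mulr.
have clsM : {in [pred x | x != 0] &, {morph cls : x y / x * y >-> x + y}}.
  move=> x y; rewrite !inE => /unitF[i ->] /unitF[j ->].
  by rewrite -exprD !clsX natrD.
pose C z := [set x : F | (x != 0) && (cls x == z)].
have cardC z : #|C z| = #|C 0|.
  have -> : C z = [set w ^+ (z : nat) * x | x in C 0].
    apply/setP=> x; apply/idP/imsetP => [|[y]]; rewrite !inE.
      case/andP=> x0 /eqP xz; have vx : (w ^+ (z : nat))^-1 * x != 0.
        by rewrite mulf_neq0 ?invr_eq0.
      exists ((w ^+ (z : nat))^-1 * x); last by rewrite mulVKf.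
      have : cls (w ^+ (z : nat) * ((w ^+ (z : nat))^-1 * x)) = z by rewrite mulVKf.
      rewrite clsM ?inE // clsX natr_Zp => /eqP.
      by rewrite -subr_eq0 addrC addrA addNr add0r => ->; rewrite vx.
    case/andP=> y0 /eqP cy ->; rewrite mulf_neq0 //= clsM ?inE // cy clsX.
    by rewrite natr_Zp addr0.
  by rewrite card_imset //; apply: mulfI.
have cardC0 : #|C 0| = f.
  have : \sum_z #|C z| = (e * f)%N.
    under eq_bigr do rewrite -sum1_card.
    have -> : (e * f = #|[pred x : F | x != 0%R]|)%N by rewrite (cardC1 (0 : F)) cardF.
    rewrite -sum1_card (partition_big cls predT) //=.
    by apply: eq_bigr => z _; apply: eq_bigl => x; rewrite !inE.
  under eq_bigr do rewrite cardC.
  rewrite sum_nat_const card_ord Zp_cast // => /eqP.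
  by rewrite eqn_pmul2l ?(ltnW e1) // => /eqP.
exists cls; split => //; first by move=> z; rewrite cardC.
have eE : (e = e./2 + e./2)%N by rewrite addnn even_halfK.
(* The square of this power is 1, and the power itself is not, its exponent being positive and below
   the order of [w]. *)
have wh : w ^+ (e./2 * f) = -1.
  have : (w ^+ (e./2 * f)) ^+ 2 == 1 by rewrite -exprM muln2 -addnn -mulnDl -eE we.
  rewrite sqrf_eq1 => /orP[|/eqP//].
  rewrite -(prim_order_dvd prim_w) => /dvdn_leq; nia.
rewrite -wh clsX -(Zp_nat_mod e1) -[in RHS](Zp_nat_mod e1) -(odd_double_half f).
rewrite odd_f.
have -> : (e./2 * (1 + f./2.*2) = f./2 * e + e./2)%N by nia.
by rewrite modnMDl.
Qed.

End CyclotomicClasses.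

(** * Moments of the number of neighbours in a class *)

Section Mixing.
Local Open Scope ring_scope.
Variables (F : finFieldType) (e f : nat) (cls : F -> 'Z_e).
Hypotheses (clsP : class_map f cls) (e1 : (1 < e)%N) (f0 : (0 < f)%N).
Hypothesis cardF : #|F| = (e * f).+1.

Lemma cls1 : cls 1 = 0.
Proof.
have [clsM _ _] := clsP; apply: (addrI (cls 1)).
by rewrite -clsM ?inE ?oner_eq0 // mulr1 addr0.
Qed.

Lemma clsV x : x != 0 -> cls x^-1 = - cls x.
Proof.
move=> x0; have [clsM _ _] := clsP; apply: (addrI (cls x)).
by rewrite subrr -clsM ?inE ?invr_eq0 // divff // cls1.
Qed.

Lemma clsN x : x != 0 -> cls (- x) = cls x + (e./2)%:R.
Proof.
move=> x0; have [clsM _ clsN1] := clsP.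
by rewrite -mulN1r clsM ?inE ?oppr_eq0 ?oner_eq0 // clsN1 addrC.
Qed.

Definition adjacent (z : 'Z_e) (x y : F) := (y - x != 0) && (cls (y - x) == z).

Definition neighbours (Y : {set F}) (z : 'Z_e) (x : F) : {set F} :=
  [set y in Y | adjacent z x y].

Lemma card_neighbours Y z x :
  (#|neighbours Y z x| = \sum_(y in Y) adjacent z x y)%N.
Proof.
rewrite -sum1_card [RHS]big_mkcond [LHS]big_mkcond /=; apply: eq_bigr => y _.
by rewrite inE; case: (y \in Y) => //=; case: (adjacent z x y).
Qed.

Lemma sum_neighbours Y z : (\sum_x #|neighbours Y z x| = #|Y| * f)%N.
Proof.
have [_ cardC _] := clsP.
under eq_bigr do rewrite card_neighbours.
rewrite exchange_big -sum_nat_const; apply: eq_bigr => y _.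
rewrite -(cardC z) -sum1_card [RHS]big_mkcond.
rewrite (reindex_inj (inv_inj (fun x => subKr y x))) /=.
by apply: eq_bigr => x _; rewrite inE /adjacent subKr; case: (_ && _).
Qed.

(** For [y != y'] the ratio [r = (y - x) / (y' - x)] determines [x]. The condition on [x] says that
    [r] has class 0, and [r] takes every such value except 1. *)
Lemma card_same_class y y' :
  #|[set x | [&& y - x != 0, y' - x != 0 & cls (y - x) == cls (y' - x)]]|
  = (if y == y' then e * f else f.-1)%N.
Proof.
have [clsM cardC _] := clsP.
case: eqVneq => [<-|yy'].
  have -> : (e * f = #|[pred x : F | x != y]|)%N by rewrite (cardC1 y) cardF.
  by apply: eq_card => x; rewrite !inE eqxx andbT andbb subr_eq0 eq_sym.
have -> : f.-1 = #|[set r | (r != 0) && (cls r == 0)] :\ 1|.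
  have := cardsD1 1 [set r : F | (r != 0) && (cls r == 0)].
  by rewrite cardC inE oner_eq0 cls1 eqxx /= => /(congr1 predn).
pose h r := (y - r * y') / (1 - r).
have hy r : r != 1 -> y - h r = r * (y' - y) / (1 - r).
  by move=> r1; rewrite /h; field; rewrite subr_eq0 eq_sym.
have hy' r : r != 1 -> y' - h r = (y' - y) / (1 - r).
  by move=> r1; rewrite /h; field; rewrite subr_eq0 eq_sym.
have d0 : y' - y != 0 by rewrite subr_eq0 eq_sym.
have hr r : r != 1 -> (y - h r) / (y' - h r) = r.
  move=> r1; rewrite hy // hy' //; have : 1 - r != 0 by rewrite subr_eq0 eq_sym.
  by move=> ?; field; apply/andP.
have h_inj : {in [set r | (r != 0) && (cls r == 0)] :\ 1 &, injective h}.
  move=> r r'; rewrite !inE => /andP[r1 _] /andP[r1' _] eh.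
  by rewrite -(hr r) // eh hr.
rewrite -(card_in_imset h_inj); apply: eq_card => x; rewrite inE.
apply/idP/imsetP => [/and3P[x0 x0' /eqP ec]|[r]].
  exists ((y - x) / (y' - x)).
    rewrite !inE mulf_neq0 ?invr_eq0 //= clsM ?inE ?invr_eq0 // clsV // ec subrr.
    rewrite eqxx andbT; apply: contra_neq yy' => /(congr1 ( *%R^~ (y' - x))).
    by rewrite mulfVK // mul1r => /addIr.
  rewrite /h; field; rewrite x0' /=.
  by rewrite [X in X != 0](_ : _ = y' - y) //; ring.
rewrite !inE => /and3P[r1 r0 /eqP cr] ->.
have r10 : 1 - r != 0 by rewrite subr_eq0 eq_sym.
rewrite hy // hy' // !mulf_neq0 ?invr_eq0 //=.
by rewrite -mulrA clsM ?inE ?mulf_neq0 ?invr_eq0 // cr add0r.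
Qed.

(* Summing over all the classes makes the second moment exact, which bounds
   each class separately: this replaces the estimation of Gauss periods. *)
Lemma sum_sqr_neighbours Y :
  (\sum_z \sum_x #|neighbours Y z x| ^ 2 + #|Y| * f.-1
   = #|Y| * (e * f) + #|Y| ^ 2 * f.-1)%N.
Proof.
have -> : (\sum_z \sum_x #|neighbours Y z x| ^ 2 =
    \sum_(y in Y) \sum_(y' in Y) if y == y' then e * f else f.-1)%N.
  under eq_bigr do under eq_bigr do
    rewrite card_neighbours expnS expn1 big_distrlr /=.
  rewrite exchange_big /=.
  under eq_bigr do rewrite exchange_big /=.
  rewrite exchange_big /=; apply: eq_bigr => y _.
  under eq_bigr do rewrite exchange_big /=.
  rewrite exchange_big /=; apply: eq_bigr => y' _.
  rewrite -card_same_class -sum1_card [RHS]big_mkcond /=.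
  apply: eq_bigr => x _; rewrite inE /adjacent.
  rewrite (bigD1 (cls (y - x))) //= eqxx andbT big1 => [|z /negPf zx].
    rewrite addn0 -[cls (y' - x) == _]eq_sym.
    by case: (y - x != 0); case: (y' - x != 0); case: (_ == _).
  by rewrite [_ == z]eq_sym zx andbF.
have -> : (#|Y| ^ 2 * f.-1 = \sum_(y in Y) \sum_(y' in Y) f.-1)%N.
  by rewrite !sum_nat_const mulnA mulnn.
rewrite -!sum_nat_const -!big_split /=; apply: eq_bigr => y yY.
rewrite (bigD1 y) //= eqxx [X in _ = (_ + X)%N](bigD1 y) //=.
rewrite -addnA; congr (_ + _)%N; rewrite addnC; congr (_ + _)%N.
by apply: eq_bigr => y' /andP[_ /negPf]; rewrite eq_sym => ->.
Qed.

(** Chebyshev's inequality. With [q = #|F|] and [n = #|Y|], the squares of [q * N - f * n], summed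
    over all [x] and all classes, give exactly [q * (q - f) * n * (q - n)], which is less than
    [q ^ 3 * n]; each [x] in [B] contributes at least [t ^ 2]. *)
Lemma card_few_neighbours (Y B : {set F}) z (t : nat) :
  (0 < #|Y|)%N ->
  {in B, forall x, #|F| * #|neighbours Y z x| + t <= f * #|Y|}%N ->
  (#|B| * t ^ 2 < #|F| ^ 3 * #|Y|)%N.
Proof.
move=> Y0 BP; pose q : int := #|F|%:Z; pose n : int := #|Y|%:Z.
pose N z x : int := #|neighbours Y z x|%:Z.
have fi : (f.-1)%:Z = f%:Z - 1 by rewrite -subn1 -subzn.
have S1 z' : \sum_x N z' x = n * f%:Z.
  under eq_bigr do rewrite /N -natz.
  by rewrite -natr_sum sum_neighbours natz PoszM.
have S2 : \sum_z' \sum_x N z' x ^+ 2 + n * (f%:Z - 1)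
    = n * (e%:Z * f%:Z) + n ^+ 2 * (f%:Z - 1).
  rewrite -fi; have /(congr1 (fun k : nat => k%:Z)) := sum_sqr_neighbours Y.
  rewrite !PoszD !PoszM => <-; congr (_ + _).
  rewrite -natz natr_sum; apply: eq_bigr => z' _; rewrite natr_sum.
  by apply: eq_bigr => x _; rewrite natrX natz.
have V z' : \sum_x (q * N z' x - f%:Z * n) ^+ 2
    = q ^+ 2 * (\sum_x N z' x ^+ 2) - q * (f%:Z * n) ^+ 2.
  transitivity (\sum_x (q ^+ 2 * N z' x ^+ 2 - (2 * q * f%:Z * n) * N z' x
                         + (f%:Z * n) ^+ 2)).
    by apply: eq_bigr => x _; ring.
  rewrite big_split /= sumrB -!mulr_sumr S1 sumr_const -/q cardT -cardE -mulr_natl -/q.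
  by rewrite natz -/q; ring.
have VS : \sum_z' \sum_x (q * N z' x - f%:Z * n) ^+ 2 = q * (q - f%:Z) * n * (q - n).
  under eq_bigr do rewrite V.
  have cardZ : #|'Z_e| = e by rewrite card_ord Zp_cast.
  rewrite sumrB -mulr_sumr sumr_const cardZ -mulr_natl natz.
  have -> : \sum_z' \sum_x N z' x ^+ 2
      = n * (e%:Z * f%:Z) + n ^+ 2 * (f%:Z - 1) - n * (f%:Z - 1).
    by rewrite -S2 addrK.
  have -> : q = e%:Z * f%:Z + 1 by rewrite /q cardF -addn1 PoszD PoszM.
  by ring.
have n_le : n <= q by rewrite lez_nat max_card.
have Vz : \sum_x (q * N z x - f%:Z * n) ^+ 2 <= q * (q - f%:Z) * n * (q - n).
  rewrite -VS [leRHS](bigD1 z) //= lerDl; apply: sumr_ge0 => z' _.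
  by apply: sumr_ge0 => x _; apply: sqr_ge0.
have VB : #|B|%:Z * t%:Z ^+ 2 <= \sum_x (q * N z x - f%:Z * n) ^+ 2.
  rewrite [leRHS](bigID (mem B)) /=; apply: ler_wpDr.
    by apply: sumr_ge0 => x _; apply: sqr_ge0.
  rewrite -natz mulr_natl -sumr_const; apply: ler_sum => x /BP.
  by rewrite -lez_nat PoszD !PoszM -/q -/n -/(N z x) => h; nia.
have n0 : 0 < n by rewrite ltz_nat.
have ff : 0 < f%:Z by rewrite ltz_nat.
have qf : f%:Z < q by rewrite ltz_nat cardF; nia.
rewrite -ltz_nat -!natz natrM natrX natrM natrX !natz -/q -/n.
by apply: le_lt_trans (le_trans VB Vz) _; nia.
Qed.

End Mixing.

(** * Greedy choice of labels with prescribed classes *)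

Lemma exists_subset_card (T : finType) (A : {set T}) n :
  n <= #|A| -> exists2 B : {set T}, B \subset A & #|B| = n.
Proof.
move=> nA; exists [set x in take n (enum A)].
  by apply/subsetP=> x; rewrite inE => /mem_take; rewrite mem_enum.
rewrite cardsE; have /card_uniqP -> := take_uniq n (enum_uniq A).
by rewrite size_takel // -cardE.
Qed.

(* [threshold e w m] elements in each candidate set suffice to choose [m] labels
   when [q <= w ^ 2]: the recursion makes [f * threshold e w m.+1] at least
   [q * (threshold e w m + m * w)], so that each of the [m] remaining sets
   excludes fewer than a fraction [1 / m] of the values of the next label. *)
Fixpoint threshold (e w m : nat) : nat :=
  if m is m'.+1 then e * (threshold e w m' + m' * w) + 1 else 0.

Lemma leq_threshold e w m n :
  0 < e -> m <= n -> threshold e w m <= threshold e w n.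
Proof.
move=> e0 /subnKC <-; elim: (n - m) => [|k IH]; first by rewrite addn0.
by rewrite addnS /=; nia.
Qed.

Section Embedding.
Local Open Scope ring_scope.
Variables (F : finFieldType) (e f : nat) (cls : F -> 'Z_e).
Hypotheses (clsP : class_map f cls) (e1 : (1 < e)%N) (f0 : (0 < f)%N).
Hypothesis cardF : #|F| = (e * f).+1.
Variable w : nat.
Hypothesis qw : (#|F| <= w ^ 2)%N.

Lemma adjacentN z x y : adjacent cls z x y -> adjacent cls (z + (e./2)%:R) y x.
Proof.
rewrite /adjacent => /andP[yx /eqP <-].
by rewrite -(opprB y) oppr_eq0 yx (clsN clsP) ?eqxx.
Qed.

(** Each [l] in [L] spoils fewer than [threshold e w m.+1 / m] values of [x], where [m] is the size
    of [L], so together they cannot exhaust [V0]. *)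
Lemma exists_good_vertex (J : eqType) (c : J -> 'Z_e) (V0 : {set F})
    (V : J -> {set F}) (L : seq J) :
  (threshold e w (size L).+1 <= f)%N -> (threshold e w (size L).+1 <= #|V0|)%N ->
  {in L, forall l, threshold e w (size L).+1 <= #|V l|}%N ->
  exists2 x, x \in V0 &
    {in L, forall l, threshold e w (size L) <= #|neighbours cls (V l) (c l) x|}%N.
Proof.
set m := size L; set s := threshold e w m; set s' := threshold e w m.+1.
move=> s'f s'V0 s'V.
have s'E : s' = (e * (s + m * w) + 1)%N by [].
pose B l := [set x | (#|neighbours cls (V l) (c l) x| < s)%N].
have cardB l : l \in L -> (#|B l| * m < s')%N.
  move=> lL; have [V' V'V cardV'] := exists_subset_card (s'V l lL).
  have : (#|B l| * (#|F| * m * w) ^ 2 < #|F| ^ 3 * #|V'|)%N.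
    apply: (card_few_neighbours clsP e1 f0 cardF (z := c l)).
      by rewrite cardV' s'E addn1.
    move=> x; rewrite inE => xB.
    have : (#|neighbours cls V' (c l) x| <= #|neighbours cls (V l) (c l) x|)%N.
      apply: subset_leq_card; apply/subsetP=> y; rewrite !inE => /andP[yV' ->].
      by rewrite (subsetP V'V).
    rewrite cardV' => /leq_ltn_trans /(_ xB).
    rewrite cardF; nia.
  rewrite cardV' => h.
  have : (#|F| ^ 3 * (#|B l| * m ^ 2) < #|F| ^ 3 * s')%N.
    apply: leq_ltn_trans h.
    have -> : (#|B l| * (#|F| * m * w) ^ 2 = #|F| ^ 2 * #|B l| * m ^ 2 * w ^ 2)%N.
      by rewrite !expnMn; ring.
    have -> : (#|F| ^ 3 * (#|B l| * m ^ 2) = #|F| ^ 2 * #|B l| * m ^ 2 * #|F|)%N by ring.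
    by rewrite leq_mul2l qw orbT.
  rewrite ltn_pmul2l ?expn_gt0 ?cardF // => /(leq_ltn_trans _); apply.
  rewrite leq_mul2l; case: (m) => [|k]; first by rewrite orbT.
  by rewrite expnS leq_pmulr ?orbT // expn_gt0.
pose good x l := (s <= #|neighbours cls (V l) (c l) x|)%N.
case: (boolP [exists x in V0, all (good x) L]).
  by case/existsP=> x /andP[xV /allP xP]; exists x.
rewrite negb_exists => /forallP noV; exfalso.
(* Without a good vertex, every element of [V0] lies in some [B l]. *)
have : (#|V0| <= \sum_(l <- L) #|B l|)%N.
  rewrite -sum1_card.
  have -> : (\sum_(l <- L) #|B l| = \sum_x \sum_(l <- L) (x \in B l))%N.
    rewrite exchange_big; apply: eq_bigr => l _; rewrite -sum1_card big_mkcond.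
    by apply: eq_bigr => x _; case: ifP.
  rewrite big_mkcond; apply: leq_sum => x _; case: ifP => // xV.
  have := noV x; rewrite xV => /allPn[l lL]; rewrite -ltnNge => xB.
  by rewrite (big_rem l) //= inE xB.
have : (m * (\sum_(l <- L) #|B l|) <= m * s'.-1)%N.
  rewrite big_distrr /= -[X in (_ <= X * _)%N](sum1_size L) big_distrl /=.
  rewrite !big_seq; apply: leq_sum => l /cardB.
  by rewrite mul1n mulnC; case: (s').
case: (posnP m) => [m0|]; last by nia.
by move/size0nil: m0 => ->; rewrite big_nil => _; lia.
Qed.

(** Once the first label [x] is chosen, every other candidate set shrinks to the neighbours of [x]
    in the prescribed class. The condition on [c] makes the two orders of a pair agree, since -1 has
    class [e / 2]. *)
Lemma embedding (J : eqType) (c : J -> J -> 'Z_e) :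
  forall (L : seq J) (V : J -> {set F}),
    {in L &, forall j l, j != l -> c l j = c j l + (e./2)%:R} ->
    uniq L -> (threshold e w (size L) <= f)%N ->
    {in L, forall j, threshold e w (size L) <= #|V j|}%N ->
  exists a : J -> F, {in L, forall j, a j \in V j} /\
    {in L &, forall j l, j != l -> adjacent cls (c j l) (a j) (a l)}.
Proof.
elim=> [|j0 L IH] V cN; first by exists (fun=> 0).
move=> /= /andP[j0L uL] sf sV.
have [||x xV0 xP] := @exists_good_vertex J (c j0) (V j0) V L sf.
- by apply: sV; rewrite mem_head.
- by move=> l lL; apply: sV; rewrite inE lL orbT.
have [|||a [aV aP]] := IH (fun l => neighbours cls (V l) (c j0 l) x) _ uL.
- by move=> j l jL lL; apply: cN; rewrite inE ?jL ?lL orbT.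
- by nia.
- by move=> l /xP.
have adj0 l : l \in L -> adjacent cls (c j0 l) x (a l).
  by move=> /aV; rewrite inE => /andP[].
exists (fun j => if j == j0 then x else a j); split=> [j|j l]; rewrite !inE.
  case: eqVneq => [->|_] //= /aV; by rewrite inE => /andP[].
case: (eqVneq j j0) => [->|jj0] /=; case: (eqVneq l j0) => [->|ll0] //=.
- by move=> _ lL _; apply: adj0.
- move=> jL _ _; rewrite cN ?mem_head ?inE ?jL ?orbT 1?eq_sym //.
  exact/adjacentN/adj0.
- by apply: aP.
Qed.

End Embedding.

(** * Comparison of the thresholds with the bound Q *)

Section Bounds.
Local Open Scope ring_scope.
Variable R : rcfType.

(** Absorb the factor [h] by [h * 'C(n, h) = n * 'C(n.-1, h.-1)] and apply the binomial theorem
    twice. *)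
Lemma UboundE e n : (0 < n)%N ->
  Ubound R e n = n%:R * (e%:R - 1) * e%:R ^+ n.-1 - e%:R ^+ n + 1.
Proof.
case: n => // n _; set x : R := e%:R - 1.
have ex : e%:R = 1 + x by rewrite addrC subrK.
have S0 m : \sum_(i < m.+1) 'C(m, i)%:R * x ^+ i = (1 + x) ^+ m.
  rewrite exprDn; apply: eq_bigr => i _.
  by rewrite expr1n mul1r mulr_natl.
rewrite /Ubound -/x big_add1 /= big_mkord.
transitivity (\sum_(i < n.+1) (n.+1%:R * x * ('C(n, i)%:R * x ^+ i)
                               - 'C(n.+1, i.+1)%:R * x ^+ i.+1)).
  apply: eq_bigr => i _; rewrite mulrBr mulr1 exprS; congr (_ - _).
  have : 'C(n.+1, i.+1)%:R * i.+1%:R = n.+1%:R * 'C(n, i)%:R :> R.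
    by rewrite -!natrM mulnC -mul_bin_diag.
  by rewrite mulrAC => ->; rewrite -!mulrA; congr (_ * _); rewrite mulrCA.
have S1 : \sum_(i < n.+1) 'C(n.+1, i.+1)%:R * x ^+ i.+1 = (1 + x) ^+ n.+1 - 1.
  by rewrite -S0 [in RHS]big_ord_recl /= bin0 expr0 mulr1 addrC addKr.
by rewrite sumrB -mulr_sumr S0 S1 ex /=; ring.
Qed.

(** The square root in Q is at least U, so Q is at least [U ^ 2]. The third hypothesis says that U
    is not negative, which keeps the subtraction of naturals exact. *)
Lemma sqr_lt_Qbound (e n q : nat) : (0 < n)%N -> (0 < e)%N ->
  (e ^ n <= n * (e - 1) * e ^ n.-1 + 1)%N -> Qbound R e n < q%:R ->
  ((n * (e - 1) * e ^ n.-1 + 1 - e ^ n) ^ 2 < q)%N.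
Proof.
move=> n0 e0 U0 Qq; set D := (_ - _)%N.
have DE : Ubound R e n = D%:R.
  by rewrite UboundE // natrB // natrD !natrM natrB // !natrX; ring.
rewrite -(ltr_nat R) natrX; apply: le_lt_trans Qq.
rewrite /Qbound DE; set c := 4%:R * _ * _.
have c0 : 0 <= c by rewrite !mulr_ge0 ?exprn_ge0 ?ler0n.
have D0 : 0 <= D%:R :> R by [].
have : D%:R <= Num.sqrt (D%:R ^+ 2 + c).
  by rewrite -{1}(ger0_norm D0) -sqrtr_sqr ler_wsqrtr // lerDl.
set s := Num.sqrt _ => Ds; nra.
Qed.

End Bounds.

(* The coefficient of [w] in [e * threshold e w m]. *)
Fixpoint main_term e m : nat :=
  if m is m'.+1 then e * main_term e m' + m' * e ^ 2 else 0.

(** The part of [e * threshold e w m] free of [w] is [B m = e + ... + e ^ m]. It is at most the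
    coefficient of [w] from [m = 3] on, but exceeds it for [m = 2]. *)
Lemma threshold_le e w m : 3 <= m -> e * threshold e w m <= main_term e m * w.+1.
Proof.
move=> m3; pose B m := iter m (fun b => e * b + e) 0.
have BS k : B k.+1 = e * B k + e by [].
have -> : e * threshold e w m = main_term e m * w + B m.
  elim: m {m3} => [|m IH]; first by rewrite muln0.
  rewrite BS /= mulnDr muln1 [e * (_ + _)]mulnDr IH; ring.
rewrite mulnS addnC leq_add2r.
elim: m m3 => // m IH; rewrite leq_eqVlt => /orP[/eqP <-|h].
  by rewrite /B /=; nia.
rewrite BS /=; have := IH h; nia.
Qed.

(** Up to rearrangement this is [main_term e m + 2 <= U]. For [m = 3] it reads
    [5 * e ^ 2 + 1 <= e ^ 3], which fails for [e = 4] and [e = 5]; from [m = 4] on, [e = 4]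
    suffices. *)
Lemma main_term_lt e m : 3 <= m -> 4 <= e -> (m = 3 -> 6 <= e) ->
  main_term e m + 1 + m * e ^ m.-1 <= m.-1 * e ^ m.
Proof.
move=> m3 e4 em.
have [m_3|m4] : m = 3 \/ 4 <= m by lia.
  by rewrite m_3 /= !expnS expn0; have := em m_3; nia.
elim: m m4 {m3 em} => // m IH; rewrite leq_eqVlt => /orP[/eqP <-|m4].
  by rewrite /= !expnS expn0; nia.
have := IH m4; case: m m4 {IH} => [//|[//|m]] m4.
rewrite -[main_term e m.+3]/(e * main_term e m.+2 + m.+2 * e ^ 2) !succnK.
have me : 2 * m.+2 <= e ^ m.+1.
  by rewrite expnS; have := ltn_expl m (_ : 1 < e); nia.
rewrite [e ^ m.+3]expnS [e ^ m.+2]expnS -mulnn.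
move: (e ^ m.+1) me (main_term e m.+2) => E me X XE.
have h1 : e * (X + 1 + m.+2 * E) <= e * (m.+1 * (e * E)).
  by rewrite leq_mul2l XE orbT.
have h2 : m.+2 * e + E <= e * E by nia.
have h3 : e * (m.+2 * e + E) <= e * (e * E) by rewrite leq_mul2l h2 orbT.
nia.
Qed.

Lemma threshold_small (R : rcfType) (e f m q : nat) :
  q = (e * f).+1 -> 3 <= m -> 4 <= e -> (m = 3 -> 6 <= e) ->
  (Qbound R e m < q%:R)%R ->
  exists w, q <= w ^ 2 /\ threshold e w m <= f.
Proof.
move=> qE m3 e4 em Qq.
have mt := main_term_lt m3 e4 em.
have eE : e ^ m = e * e ^ m.-1 by rewrite -expnS prednK //; lia.
have DE : m * (e - 1) * e ^ m.-1 + 1 = m.-1 * e ^ m - m * e ^ m.-1 + 1 + e ^ m.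
  by rewrite eE in mt *; move: (e ^ m.-1) mt => E mt; nia.
have := sqr_lt_Qbound _ _ _ Qq; rewrite DE addnK leq_addl => /(_ _ _ isT) Dq.
have {}Dq : (main_term e m + 2) ^ 2 < q.
  apply: leq_ltn_trans (Dq _ _); [|lia..].
  by rewrite leq_exp2r //; lia.
have [w qw w_min] : exists2 w, q <= w ^ 2 & forall u, q <= u ^ 2 -> w <= u.
  have ex : exists w, q <= w ^ 2 by exists q; nia.
  by exists (ex_minn ex); case: ex_minnP.
exists w; split=> //; case: w qw w_min => [|u] qu u_min; first by lia.
have uq : u ^ 2 < q by rewrite ltnNge; apply/negP=> /u_min; lia.
have Au : main_term e m + 2 <= u.
  by rewrite -ltnS -(@ltn_exp2r _ _ 2) //; apply: leq_trans Dq qu.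
(* As [w = u + 1], the bound is [main_term e m * (u + 2) <= (u - 2) * (u + 2) < u ^ 2 <= e * f]. *)
have := threshold_le e u.+1 m3; nia.
Qed.

(** * Labelling a strong difference family *)

Lemma card_involution (P : finType) (tau : P -> P) (A : {set P}) (pos : pred P) :
  involutive tau -> (forall p, (tau p \in A) = (p \in A)) ->
  {in A, forall p, pos (tau p) = ~~ pos p} ->
  #|A| = #|[set p in A | pos p]|.*2.
Proof.
move=> tauK tauA pos_tau; rewrite -addnn -(cardsID [set p | pos p] A).
congr (_ + _); first by apply: eq_card => p; rewrite !inE.
rewrite -(card_imset _ (inv_inj tauK)); apply: eq_card => p; rewrite !inE.
apply/imsetP/andP => [[p']|[pA pp]].
  by rewrite !inE => /andP[np pA] ->; rewrite tauA pos_tau // np.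
by exists (tau p); rewrite ?tauK // !inE tauA pA pos_tau // pp.
Qed.

Lemma ltn_enum_rank (T : finType) (x y : T) : x != y ->
  (enum_rank x < enum_rank y) = ~~ (enum_rank y < enum_rank x).
Proof.
move=> xy; rewrite -leqNgt [LHS]ltn_neqAle; case: eqP => //= rxy.
by rewrite (enum_rank_inj (ord_inj rxy)) eqxx in xy.
Qed.

Lemma free_involution_even (P : finType) (tau : P -> P) (A : {set P}) :
  involutive tau -> (forall p, (tau p \in A) = (p \in A)) ->
  {in A, forall p, tau p != p} -> ~~ odd #|A|.
Proof.
move=> tauK tauA free.
pose pos p := enum_rank p < enum_rank (tau p).
rewrite (card_involution (pos := pos) tauK tauA) ?odd_double //.
by move=> p /free pp; rewrite /pos tauK ltn_enum_rank.
Qed.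

(** * Distribution of the classes over the pairs of equal quotient *)

Section Colouring.
Local Open Scope ring_scope.
Variables (P X : finType) (tau : P -> P) (inv : X -> X) (d : P -> X).
Variables (A : {set P}) (e : nat).
Hypotheses (e1 : (1 < e)%N) (even_e : ~~ odd e).
Hypothesis tauA : forall p, (tau p \in A) = (p \in A).
Hypothesis tauK : involutive tau.
Hypothesis tau_free : forall p, p \in A -> tau p != p.
Hypothesis invK : involutive inv.
Hypothesis d_tau : forall p, d (tau p) = inv (d p).
Hypothesis card_fibre : forall x, #|[set p in A | d p == x]| = e.

(** Number the chosen representatives of the [tau]-orbits within each fibre of [d], and shift the
    colour of their partners by [e / 2]. A fibre with [x = inv x] has [e / 2] representatives, using
    the lower half of the colours, and their partners use the upper half; of two fibres exchanged by
    [inv], one consists of representatives only. *)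
Lemma colouring_exists :
  exists c : P -> 'Z_e, (forall p, p \in A -> c (tau p) = c p + (e./2)%:R) /\
    {in A &, forall p p', d p = d p' -> c p = c p' -> p = p'}.
Proof.
(* [pos] selects one element of each orbit: by rank of the elements inside a self-inverse fibre,
   otherwise by rank of the fibres, so that whole fibres are selected. *)
pose pos p := if d p == inv (d p) then (enum_rank p < enum_rank (tau p))%N
  else (enum_rank (d p) < enum_rank (inv (d p)))%N.
pose S x := [set p in A | (d p == x) && pos p].
pose idx p := index p (enum (S (d p))).
pose c p : 'Z_e := if pos p then (idx p)%:R else (idx (tau p))%:R + (e./2)%:R.
have eE : (e = e./2 + e./2)%N by rewrite addnn even_halfK.
have hh : (e./2)%:R + (e./2)%:R = 0 :> 'Z_e by rewrite -natrD -eE pchar_Zp.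
have pos_tau p : p \in A -> pos (tau p) = ~~ pos p.
  move=> pA; rewrite /pos d_tau invK tauK eq_sym.
  case: eqVneq => [_|dp]; first by rewrite ltn_enum_rank ?tau_free.
  by rewrite ltn_enum_rank // eq_sym.
have S_idx p : p \in A -> pos p -> (idx p < #|S (d p)|)%N.
  by move=> pA pp; rewrite cardE index_mem mem_enum inE pA eqxx.
have S_le x : (#|S x| <= e)%N.
  rewrite -(card_fibre x); apply: subset_leq_card; apply/subsetP=> p.
  by rewrite !inE => /and3P[-> ->].
have S_half x : x = inv x -> #|S x| = e./2.
  move=> xx; suff -> : e = #|S x|.*2 by rewrite doubleK.
  rewrite -[LHS](card_fibre x) (card_involution (pos := pos) tauK).
  - by congr _.*2; apply: eq_card => p; rewrite !inE andbA.
  - by move=> p; rewrite !inE tauA d_tau [in LHS]xx (inj_eq (inv_inj invK)).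
  - by move=> p; rewrite !inE => /andP[pA _]; apply: pos_tau.
have idx_inj p p' : p \in A -> p' \in A -> pos p -> pos p' -> d p = d p' ->
    (idx p)%:R = (idx p')%:R :> 'Z_e -> p = p'.
  move=> pA pA' pp pp' dd /(congr1 val) /=.
  rewrite !val_Zp_nat // !modn_small ?(leq_trans (S_idx _ _ _)) //.
  rewrite /idx -dd => /(index_inj p); apply; rewrite mem_enum inE.
    by rewrite pA pp eqxx.
  by rewrite pA' pp' dd eqxx.
(* Both kinds of elements occur only in a self-inverse fibre, where all indices are below
   [e / 2]. *)
have mixed p p' : p \in A -> p' \in A -> pos p -> ~~ pos p' -> d p = d p' -> c p <> c p'.
  move=> pA pA' pp pp' dd; rewrite /c pp (negPf pp').
  have dinv : d p = inv (d p).
    by apply/eqP; move: pp pp'; rewrite /pos -dd; case: eqP => // _ ->.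
  have := S_idx p pA pp; have := S_idx (tau p'); rewrite tauA pos_tau // pp'.
  move=> /(_ pA' isT); rewrite d_tau -dd -dinv S_half // => i1 i2.
  rewrite -natrD => /(congr1 val) /=.
  by rewrite !val_Zp_nat // !modn_small; lia.
exists c; split=> [p pA|p p' pA pA' dd].
  rewrite /c pos_tau // tauK; case: (pos p) => //=.
  by rewrite -addrA hh addr0.
case pp: (pos p); case pp': (pos p').
- by rewrite /c pp pp'; apply: idx_inj.
- by move/(mixed p p' pA pA' pp (negbT pp') dd).
- by move/esym/(mixed p' p pA' pA pp' (negbT pp) (esym dd)).
rewrite /c pp pp' => /addIr h; apply: (inv_inj tauK); apply: idx_inj h.
- by rewrite tauA.
- by rewrite tauA.
- by rewrite pos_tau // pp.
- by rewrite pos_tau // pp'.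
- by rewrite !d_tau dd.
Qed.

End Colouring.

Section Labelling.
Variables (G : finGroupType) (I J : finType) (blk : J -> I) (b : J -> G).

Definition block i : {set J} := [set j | blk j == i].

Definition same_block : {set J * J} :=
  [set p : J * J | (blk p.1 == blk p.2) && (p.1 != p.2)].

Definition quot (p : J * J) : G := (b p.1 * (b p.2)^-1)%g.

Definition strong_difference : Prop :=
  forall x, #|[set p in same_block | quot p == x]| = #|J|.

Hypothesis sdf : strong_difference.
Hypothesis J0 : 0 < #|J|.

Lemma swap_same_block p : (swap_pair p \in same_block) = (p \in same_block).
Proof. by rewrite !inE /= eq_sym [_.2 == _]eq_sym. Qed.

Lemma quot_swap p : quot (swap_pair p) = (quot p)^-1%g.
Proof. by rewrite /quot invMg invgK. Qed.

Lemma swap_neq p : p \in same_block -> swap_pair p != p.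
Proof.
by case: p => j l; rewrite inE /= => /andP[_ jl]; apply: contraNneq jl => -[->].
Qed.

(** Swapping is a free involution on the pairs of quotient 1, since 1 is its own inverse. *)
Lemma even_card_positions : ~~ odd #|J|.
Proof.
rewrite -(sdf 1%g); apply: (@free_involution_even _ (swap_pair)).
- by case.
- move=> p; rewrite [LHS]inE [RHS]inE swap_same_block quot_swap.
  by rewrite -[X in _ == X]invg1 (inj_eq invg_inj).
- by move=> p; rewrite !inE => /andP[h _]; apply: swap_neq; rewrite inE.
Qed.

(** Both sides count the ordered pairs of positions in a common block: [#|J|] for each quotient, and
    [#|J|] pairs of equal positions. *)
Lemma sum_card_block : \sum_j #|block (blk j)| = #|J| * #|G|.+1.
Proof.
have -> : #|J| * #|G|.+1 = #|same_block| + #|J|.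
  rewrite mulnS addnC mulnC; congr (_ + _).
  rewrite -sum_nat_const -[in RHS]sum1_card (partition_big quot predT) //=.
  by apply: eq_bigr => x _; rewrite -(sdf x) -sum1_card; apply: eq_bigl => p; rewrite inE.
have -> : #|same_block| = \sum_j \sum_l ((j, l) \in same_block).
  rewrite pair_bigA /= -sum1_card big_mkcond /=.
  by apply: eq_bigr => -[j l] _; case: ifP.
rewrite -[X in _ = _ + X]sum1_card -big_split /=; apply: eq_bigr => j _.
rewrite (cardD1 j) inE eqxx addnC -sum1_card big_mkcond; congr (_ + _).
apply: eq_bigr => l _; rewrite !inE /= [j == l]eq_sym [blk j == _]eq_sym andbC.
by case: (_ && _).
Qed.

Variable k : nat.
Hypothesis block_le : forall i, #|block i| <= k.
Hypothesis block_k : exists i, #|block i| = k.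

Lemma leq_block_positions : k <= #|J|.
Proof. by have [i <-] := block_k; apply: max_card. Qed.

(** The number of positions is even and at least 3. If it were 4, the blocks would have sizes 3 and
    1, and the sum of their squares, 10, would be a multiple of 4. *)
Lemma six_positions : k = 3 -> 6 <= #|J|.
Proof.
move=> k3; have := leq_block_positions; have := even_card_positions.
suff : #|J| != 4 by rewrite k3; lia.
apply/eqP=> J4; have [i] := block_k; rewrite k3 => ik.
have := sum_card_block; rewrite (bigID (mem (block i))) /= J4.
have -> : \sum_(j in block i) #|block (blk j)| = 9.
  rewrite (eq_bigr (fun=> 3)) ?sum_nat_const ?ik // => j.
  by rewrite inE => /eqP ->.
have cC : #|~: block i| = 1 by have := cardsC (block i); rewrite ik J4; lia.
have -> : \sum_(j | j \notin block i) #|block (blk j)| = 1.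
  rewrite (eq_bigr (fun=> 1)) => [|j jN].
    by rewrite sum1_card -[RHS]cC; apply: eq_card => j; rewrite unfold_in !inE.
  apply/eqP; rewrite eqn_leq; apply/andP; split.
    rewrite -cC; apply: subset_leq_card; apply/subsetP=> l; rewrite !inE => /eqP ->.
    by move: jN; rewrite inE.
  by apply/card_gt0P; exists j; rewrite inE.
by lia.
Qed.

Section Field.
Local Open Scope ring_scope.
Variables (R : rcfType) (F : finFieldType) (f : nat) (cls : F -> 'Z_#|J|).
Hypotheses (clsP : class_map f cls) (f0 : (0 < f)%N).
Hypothesis cardF : #|F| = (#|J| * f).+1.

(** There are [#|J|] classes, [#|J|] labels and [#|J|] pairs of each quotient, so injectivity means
    that every class occurs exactly once. *)
Definition labelling (a : J -> F) : Prop :=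
  [/\ forall j, a j != 0, injective (cls \o a)
    & {in same_block &, forall p p', quot p = quot p' ->
        cls (a p.1 - a p.2) = cls (a p'.1 - a p'.2) -> p = p'}].

Let e1 : (1 < #|J|)%N.
Proof. by have := even_card_positions; have := J0; lia. Qed.

Lemma class_repr : exists y : 'Z_#|J| -> F, forall z, y z != 0 /\ cls (y z) = z.
Proof.
have [_ cardC _] := clsP.
apply: (@fin_all_exists _ (fun=> F) (fun z y => y != 0 /\ cls y = z)) => z.
have /card_gt0P[x] : (0 < #|[set x : F | (x != 0%R) && (cls x == z)]|)%N by rewrite cardC.
by rewrite inE => /andP[x0 /eqP xz]; exists x.
Qed.

Lemma labelling_large : (2 < k)%N -> Qbound R #|J| k < #|F|%:R ->
  exists a, labelling a.
Proof.
move=> k2 Qq; have [clsM cardC _] := clsP.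
have [w [qw thr]] : exists w, (#|F| <= w ^ 2)%N /\ (threshold #|J| w k <= f)%N.
  apply: (threshold_small cardF k2 _ six_positions Qq).
  by have := leq_block_positions; have := even_card_positions; lia.
have [c [cN c_inj]] := colouring_exists e1 even_card_positions swap_same_block
  (@swap_pairK _ _) swap_neq (@invgK G) quot_swap sdf.
(* Distinct classes are imposed on the labels in advance, so the blocks can be labelled
   independently of each other. *)
pose V (j : J) := [set x : F | (x != 0) && (cls x == (enum_rank j)%:R)].
have /fin_all_exists[a aP] i : exists a : J -> F,
    {in enum (block i), forall j, a j \in V j} /\
    {in enum (block i) &, forall j l, j != l -> adjacent cls (c (j, l)) (a j) (a l)}.
  have thr_i : (threshold #|J| w (size (enum (block i))) <= f)%N.
    by apply: leq_trans thr; apply: leq_threshold => //; rewrite -cardE block_le.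
  apply: (embedding clsP e1 f0 cardF qw) => //.
  - move=> j l; rewrite !mem_enum !inE => /eqP ji /eqP li jl.
    by rewrite -(cN (j, l)) // inE /= ji li eqxx.
  - exact: enum_uniq.
  - by move=> j _; rewrite cardC.
have aV j : a (blk j) j \in V j by apply: (aP _).1; rewrite mem_enum inE.
exists (fun j => a (blk j) j); split.
- by move=> j; have := aV j; rewrite inE => /andP[].
- move=> j l /=; have := aV j; have := aV l; rewrite !inE.
  move=> /andP[_ /eqP ->] /andP[_ /eqP ->] /(congr1 val) /=.
  by rewrite !val_Zp_nat // !modn_small //; move=> /ord_inj/enum_rank_inj.
have clsc p : p \in same_block -> cls (a (blk p.2) p.2 - a (blk p.1) p.1) = c p.
  case: p => j l; rewrite inE /= => /andP[/eqP jl njl].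
  have := (aP (blk j)).2 j l; rewrite !mem_enum !inE jl eqxx => /(_ isT isT njl).
  by rewrite /adjacent => /andP[_ /eqP].
move=> p p' pA pA' dd.
(* [adjacent] concerns the second label minus the first, whereas [labelling] subtracts in the
   opposite order. *)
have /= := clsc (swap_pair p); rewrite swap_same_block => /(_ pA) ->.
have /= := clsc (swap_pair p'); rewrite swap_same_block => /(_ pA') -> h.
apply: (can_inj (@swap_pairK J J)); apply: c_inj h; rewrite ?swap_same_block //.
by rewrite !quot_swap dd.
Qed.

(* By counting, the group is trivial and every block is a pair; it is labelled
   [y, -y] as in the patterned starter. *)
Lemma labelling_small : (k <= 2)%N -> exists a, labelling a.
Proof.
move=> k2; have [clsM cardC clsN1] := clsP.
(* The sum of [#|block (blk j)|] over all positions is at most [2 * #|J|], with equality only if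
   every block is a pair; it equals [#|J| * #|G|.+1], and [G] is not empty. *)
have block2 j : #|block (blk j)| = 2.
  apply/eqP; rewrite eqn_leq (leq_trans (block_le _)) //= ltnNge; apply/negP=> j1.
  have : (\sum_j #|block (blk j)| < \sum_(j : J) 2)%N.
    rewrite (bigD1 j) //= [X in (_ < X)%N](bigD1 j) //= -addSn leq_add //.
    by apply: leq_sum => l _; apply: leq_trans (block_le _) k2.
  rewrite sum_card_block sum_nat_const ltn_mul2l => /andP[_].
  by rewrite !ltnS leqNgt => /negP[]; apply/card_gt0P; exists 1%g.
have /fin_all_exists[tau tauP] j : exists l,
    [/\ l != j, blk l = blk j & forall m, blk m = blk j -> m != j -> m = l].
  have /eqP : #|block (blk j) :\ j| = 1%N.
    by have := block2 j; rewrite (cardsD1 j) inE eqxx => -[].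
  case/cards1P => l lP; exists l; have := set11 l; rewrite -lP !inE => /andP[lj /eqP bl].
  by split=> // m bm mj; apply/set1P; rewrite -lP !inE mj bm eqxx.
have tau_free j : tau j != j by case: (tauP j).
have blk_tau j : blk (tau j) = blk j by case: (tauP j).
have tauK : involutive tau.
  by move=> j; have [_ _ h] := tauP (tau j); rewrite -(h j) ?blk_tau // eq_sym.
(* The colouring is now applied to the positions themselves, with a single fibre: partners get
   classes differing by [e / 2], as [y] and [-y] do. *)
have [c [cN c_inj]] : exists c : J -> 'Z_#|J|,
    (forall j, j \in [set: J] -> c (tau j) = c j + (#|J|./2)%:R) /\
    {in [set: J] &, forall j l, tt = tt -> c j = c l -> j = l}.
  apply: (colouring_exists (tau := tau) (inv := id) e1 even_card_positions) => //.
  by move=> j; rewrite !inE.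
  by case; rewrite -cardsT; apply: eq_card => j; rewrite !inE eqxx.
have [y yP] := class_repr.
have hh : (#|J|./2)%:R + (#|J|./2)%:R = 0 :> 'Z_#|J|.
  by rewrite -natrD addnn even_halfK ?even_card_positions // pchar_Zp.
pose pos j := (enum_rank j < enum_rank (tau j))%N.
pose a j := if pos j then y (c j) else - y (c (tau j)).
have a0 j : a j != 0.
  by rewrite /a; case: ifP; rewrite ?oppr_eq0 (yP _).1.
have cls_a j : cls (a j) = c j.
  rewrite /a; case: ifP => _; first by rewrite (yP _).2.
  by rewrite (clsN clsP) ?(yP _).1 // (yP _).2 cN // -addrA hh addr0.
have aN j : a (tau j) = - a j.
  rewrite /a /pos tauK ltn_enum_rank //.
  by case: (enum_rank j < _)%N; rewrite ?opprK.
(* In characteristic 2, -1 would be 1, of class 0 instead of [e / 2]. *)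
have two0 : 2 != 0 :> F.
  apply/negP=> /eqP two0; have N1 : -1 = 1 :> F.
    by apply/eqP; rewrite eq_sym -subr_eq0 opprK -[1 + 1]/(2%:R) two0.
  have half : (0 < #|J|./2 < #|J|)%N.
    by have := e1; have := even_card_positions; case: #|J| => [|[|n]]; lia.
  have := clsN1; rewrite N1 (cls1 clsP) => /(congr1 val) /=.
  by rewrite val_Zp_nat // modn_small; case/andP: half => // + _; case: _./2.
exists a; split=> // [j l /=|].
  by rewrite !cls_a; apply: c_inj.
have pE p : p \in same_block -> p.2 = tau p.1 /\ cls (a p.1 - a p.2) = cls 2 + c p.1.
  case: p => j l; rewrite inE /= => /andP[/eqP jl njl].
  have -> : l = tau j by have [_ _] := tauP j; apply; rewrite 1?eq_sym.
  split=> //; have -> : a j - a (tau j) = 2 * a j.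
    by rewrite aN opprK -mulr2n mulr_natl.
  by rewrite clsM ?inE ?a0 // cls_a.
move=> [j l] [j' l'] /pE /= [-> ->] /pE /= [-> ->] _ /addrI jj'.
by rewrite (c_inj j j').
Qed.

Lemma labelling_exists : Qbound R #|J| k < #|F|%:R -> exists a, labelling a.
Proof.
by case: (leqP k 2) => [k2 _|]; [apply: labelling_small | apply: labelling_large].
Qed.

End Field.
End Labelling.

(** * The resolved linear space *)

Section Design.
Local Open Scope ring_scope.
Variables (G : finGroupType) (I J : finType) (blk : J -> I) (b : J -> G).
Variables (F : finFieldType) (f : nat) (cls : F -> 'Z_#|J|) (a : J -> F).
Hypotheses (sdf : strong_difference blk b) (J1 : (1 < #|J|)%N).
Hypotheses (clsP : class_map f cls) (aP : labelling blk b cls a).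
Hypothesis blk_onto : forall i, exists j, blk j = i.

Local Notation T := (G * F)%type.

(* [Some (i, s, u)] indexes the multiple by [s] (of class 0) of the i-th lifted
   block, translated by [u]; [None] indexes the fibre of [G * F -> F]. *)
Definition index_ok (o : option (I * F * G)) : bool :=
  if o is Some (_, s, _) then (s != 0) && (cls s == 0) else true.

Definition dblock (x : F) (o : option (I * F * G)) : {set T} :=
  if o is Some (i, s, u)
  then [set ((b j * u)%g, a j * s + x) | j in block blk i]
  else [set p : T | p.2 == x].

Definition pclass (x : F) : {set {set T}} := [set dblock x o | o in index_ok].

Definition pclasses : {set {set {set T}}} := [set pclass x | x : F].

Lemma labelled_diff_neq0 p : p \in same_block blk -> a p.1 - a p.2 != 0.
Proof.
case: aP => _ a_inj _; rewrite inE subr_eq0 => /andP[_]; apply: contra_neq => h.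
by apply: a_inj; rewrite /= h.
Qed.

Lemma card_class_index : #|{: 'Z_(#|J|)}| = #|J|.
Proof. by rewrite card_ord Zp_cast. Qed.

Lemma labels_onto z : exists j, cls (a j) = z.
Proof.
case: aP => _ a_inj _.
have [|g _ gK] := inj_card_bij a_inj; first by rewrite card_class_index.
by exists (g z); apply: (gK z).
Qed.

Lemma labelled_diff_onto x z : exists p,
  [/\ p \in same_block blk, quot b p = x & cls (a p.1 - a p.2) = z].
Proof.
case: aP => _ _ d_inj; pose A := [set p in same_block blk | quot b p == x].
have /setP/(_ z) : [set cls (a p.1 - a p.2) | p in A] = setT.
  apply/eqP; rewrite eqEcard subsetT cardsT card_class_index card_in_imset ?sdf ?leqnn //.
  move=> p p'; rewrite !inE => /andP[pA /eqP px] /andP[pA' /eqP px'].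
  by apply: d_inj => //; rewrite ?inE // px px'.
rewrite inE => /imsetP[p]; rewrite inE => /andP[pA /eqP px] ->.
by exists p.
Qed.

Lemma cls_div x y : x != 0 -> y != 0 -> cls x = cls y -> x / y != 0 /\ cls (x / y) = 0.
Proof.
have [clsM _ _] := clsP; move=> x0 y0 xy; rewrite mulf_neq0 ?invr_eq0 //.
by rewrite clsM ?inE ?invr_eq0 // (clsV clsP) // xy subrr.
Qed.

Lemma cls_mul x s : x != 0 -> s != 0 -> cls s = 0 -> cls (x * s) = cls x.
Proof. by have [clsM _ _] := clsP => x0 s0 s1; rewrite clsM ?inE // s1 addr0. Qed.

Lemma dblockP x i s u (p : T) :
  reflect (exists2 j, blk j = i & p = ((b j * u)%g, a j * s + x))
    (p \in dblock x (Some (i, s, u))).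
Proof.
by apply: (iffP imsetP) => -[j ji ->]; exists j => //; move: ji; rewrite inE => /eqP.
Qed.

Lemma point_cover x (p : T) : exists2 o, index_ok o & p \in dblock x o.
Proof.
case: p => v y; case: (eqVneq y x) => [yx|yx]; first by exists None; rewrite // inE yx /=.
have [a0 _ _] := aP; have [j ja] := labels_onto (cls (y - x)).
have yx0 : y - x != 0 by rewrite subr_eq0.
have [s0 s1] := cls_div yx0 (a0 j) (esym ja).
exists (Some (blk j, (y - x) / a j, ((b j)^-1 * v)%g)); first by rewrite /= s0 s1 eqxx.
by apply/dblockP; exists j => //; rewrite mulKVg mulrC divfK ?subrK.
Qed.

Lemma point_uniq x (p : T) o o' : index_ok o -> index_ok o' ->
  p \in dblock x o -> p \in dblock x o' -> o = o'.
Proof.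
have [a0 a_inj _] := aP.
have neqx j s : s != 0 -> (a j * s + x == x) = false.
  by move=> s0; rewrite -subr_eq0 addrK mulf_eq0 (negPf (a0 j)) (negPf s0).
case: o => [[[i s] u]|]; case: o' => [[[i' s'] u']|] //=.
- move=> /andP[s0 /eqP s1] /andP[s0' /eqP s1'].
  move=> /dblockP[j <- ->] /dblockP[j' <- [bE /addIr aE]].
  have jj' : j = j'.
    by apply: a_inj; rewrite /= -(cls_mul (a0 j) s0 s1) aE cls_mul.
  by move: bE aE; rewrite -jj' => /mulgI -> /(mulfI (a0 j)) ->.
- by move=> /andP[s0 _] _ /dblockP[j _ ->]; rewrite inE /= neqx.
- by move=> _ /andP[s0 _] + /dblockP[j _ pE]; rewrite pE inE /= neqx.
Qed.

(** For distinct second coordinates, the quotient of the first coordinates and the class of [y - y']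
    select a pair of positions; the value of [y - y'] then fixes the multiplier [s], and the point
    [p] fixes both translations. *)
Lemma pair_cover (p p' : T) : p != p' ->
  exists x o, [/\ index_ok o, p \in dblock x o & p' \in dblock x o].
Proof.
case: p p' => [v y] [v' y']; case: (eqVneq y y') => [<- _|yy _].
  by exists y, None; rewrite !inE /= eqxx.
have [[j l] /= [pA dq dc]] := labelled_diff_onto (v * v'^-1)%g (cls (y - y')).
have d0 := labelled_diff_neq0 pA; have yy0 : y - y' != 0 by rewrite subr_eq0.
have [s0 s1] := cls_div yy0 d0 (esym dc).
set s := _ / _ in s0 s1; have sE : (a j - a l) * s = y - y' by rewrite mulrC divfK.
move: pA; rewrite inE /= => /andP[/eqP jl _].
exists (y - a j * s), (Some (blk j, s, ((b j)^-1 * v)%g)); split.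
- by rewrite /= s0 s1 eqxx.
- by apply/dblockP; exists j => //; rewrite mulKVg addrC subrK.
apply/dblockP; exists l => //; congr (_, _).
  rewrite /quot /= in dq; have -> : v = ((b j * (b l)^-1) * v')%g by rewrite dq mulgKV.
  by rewrite -!mulgA mulKg mulKVg.
by rewrite -[y'](subKr y) -sE; ring.
Qed.

Lemma pair_uniq (p p' : T) x o x' o' : p != p' -> index_ok o -> index_ok o' ->
  p \in dblock x o -> p' \in dblock x o ->
  p \in dblock x' o' -> p' \in dblock x' o' -> x = x' /\ o = o'.
Proof.
have [a0 a_inj d_inj] := aP; move=> pp ok ok' h1 h2 h1' h2'.
(* Within one parallel class a single point determines the block. A fibre and a lifted block never
   share two points, as the labels of a block are distinct. *)
suff xx : x = x' by split=> //; rewrite -xx in h1'; apply: point_uniq h1 h1'.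
case: o ok h1 h2 => [[[i s] u]|] /=; case: o' ok' h1' h2' => [[[i' s'] u']|] /=.
- move=> /andP[s0' /eqP s1'] /dblockP[j' bj' pE'] /dblockP[l' bl' pE2'].
  move=> /andP[s0 /eqP s1] /dblockP[j bj pE] /dblockP[l bl pE2].
  have jl : (j, l) \in same_block blk.
    by rewrite inE /= bj bl eqxx; apply: contra_neq pp => h; rewrite pE pE2 h.
  have jl' : (j', l') \in same_block blk.
    by rewrite inE /= bj' bl' eqxx; apply: contra_neq pp => h; rewrite pE' pE2' h.
  move: pE2 pE2'; rewrite pE in pE' *; case: pE' => bE aE -> [bE2 aE2].
  have sE : (a j - a l) * s = (a j' - a l') * s'.
    transitivity ((a j * s + x) - (a l * s + x)); first by ring.
    by rewrite aE aE2; ring.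
  have [jj ll] : (j, l) = (j', l').
    apply: d_inj => //=.
      rewrite /quot /= -[b j](mulgK u) -[b l](mulgK u) bE bE2.
      by rewrite !invMg !invgK -!mulgA mulKg mulKVg.
    by rewrite -(cls_mul (labelled_diff_neq0 jl) s0 s1) sE cls_mul ?(labelled_diff_neq0 jl').
  move: sE aE; rewrite -jj -ll => /(mulfI (labelled_diff_neq0 jl)) ->.
  by move/addrI.
- move=> _; rewrite !inE => /eqP p2 /eqP p2' /andP[s0 _].
  move=> /dblockP[j _ pE] /dblockP[l _ pE'].
  case/negP: pp; rewrite pE pE' in p2 p2' *; move: p2.
  rewrite -p2' /= => /addIr/(mulIf s0) jl.
  by rewrite (a_inj j l) //= jl.
- move=> /andP[s0 _] /dblockP[j _ pE] /dblockP[l _ pE'] _.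
  rewrite !inE => /eqP p2 /eqP p2'.
  case/negP: pp; rewrite pE pE' in p2 p2' *; move: p2.
  rewrite -p2' /= => /addIr/(mulIf s0) jl.
  by rewrite (a_inj j l) //= jl.
- by move=> _; rewrite !inE => /eqP <- _ _ /eqP <-.
Qed.

Lemma dblock_neq0 x o : dblock x o != set0.
Proof.
apply/set0Pn; case: o => [[[i s] u]|]; last by exists (1%g, x); rewrite inE /=.
have [j ji] := blk_onto i; exists ((b j * u)%g, a j * s + x).
by apply/dblockP; exists j.
Qed.

Lemma pclass_partition x : partition (pclass x) [set: T].
Proof.
apply/and3P; split.
- apply/eqP/setP=> p; rewrite inE; have [o ok po] := point_cover x p.
  by apply/bigcupP; exists (dblock x o); rewrite // imset_f.
- apply/trivIsetP=> _ _ /imsetP[o ok ->] /imsetP[o' ok' ->]; apply: contra_neqT.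
  case/pred0Pn=> p /andP[po po']; congr dblock; exact: point_uniq po po'.
- by apply/imsetP=> -[o _ /esym/eqP]; rewrite (negPf (dblock_neq0 x o)).
Qed.

(** The classes are concatenated rather than united because a one-point block may belong to several
    of them. *)
Definition dblocks : seq {set T} := flatten [seq enum P | P : {set {set T}} in pclasses].

Lemma dblocksP B : reflect (exists x o, index_ok o /\ B = dblock x o) (B \in dblocks).
Proof.
apply: (iffP flatten_mapP) => [[P]|[x [o [ok ->]]]].
  rewrite mem_enum => /imsetP[x _ ->]; rewrite mem_enum => /imsetP[o ok ->].
  by exists x, o.
by exists (pclass x); rewrite mem_enum ?imset_f.
Qed.

Lemma count_dblocks (r : pred {set T}) :
  count r dblocks = (\sum_(P in pclasses) #|[set B in P | r B]|)%N.
Proof.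
rewrite count_flatten sumnE -map_comp big_map big_enum /=.
apply: eq_bigr => P _; rewrite -size_filter cardE; congr size.
by rewrite [in RHS]/enum_mem -filter_predI; apply: eq_filter => B; rewrite !inE andbC.
Qed.

Lemma count_pair (p p' : T) : p != p' ->
  count (fun B : {set T} => (p \in B) && (p' \in B)) dblocks = 1%N.
Proof.
move=> pp; have [x [o [ok po po']]] := pair_cover pp.
have uniqB x' B : B \in pclass x' -> p \in B -> p' \in B -> x' = x /\ B = dblock x o.
  case/imsetP=> o' ok' -> po1 po1'.
  by have [-> ->] := pair_uniq pp ok' ok po1 po1' po po'.
rewrite count_dblocks (bigD1 (pclass x)) ?imset_f //=.
rewrite big1 => [|P /andP[/imsetP[x' _ ->] xx']].
  rewrite addn0; apply/eqP/cards1P; exists (dblock x o); apply/setP=> B; rewrite !inE.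
  apply/andP/eqP => [[Bx /andP[pB pB']]|->]; first by have [] := uniqB x B Bx pB pB'.
  by rewrite po po' imset_f.
apply/eqP; rewrite cards_eq0; apply/eqP/setP=> B; rewrite !inE.
apply: contraNF xx' => /andP[Bx /andP[pB pB']].
by have [-> _] := uniqB x' B Bx pB pB'.
Qed.

Lemma card_dblock x o : index_ok o ->
  #|dblock x o| = if o is Some (i, _, _) then #|block blk i| else #|G|.
Proof.
case: o => [[[i s] u]|] /=; last first.
  move=> _; have inj : injective (fun v : G => (v, x) : T) by move=> v v' [].
  rewrite -(card_imset _ inj); apply: eq_card => -[v y]; rewrite inE /=.
  by apply/eqP/imsetP => [->|[v' _ [_ ->]]//]; exists v.
case/andP=> s0 _; apply: card_imset => j l [_ /addIr/(mulIf s0) jl].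
by have [_ a_inj _] := aP; apply: a_inj; rewrite /= jl.
Qed.

(** [G] acts on the right, which leaves the quotients [b j * (b l)^-1] unchanged even if [G] is not
    commutative. *)
Definition shift (t p : T) : T := ((p.1 * t.1)%g, p.2 + t.2).

Lemma shift_inj t : injective (shift t).
Proof. by move=> [v y] [v' y'] [/mulIg -> /addIr ->]. Qed.

Definition translation t : {perm T} := perm (@shift_inj t).

Definition translations : {set {perm T}} := [set translation t | t : T].

Lemma translations_group_set : group_set translations.
Proof.
apply/group_setP; split.
  apply/imsetP; exists (1%g, 0) => //; apply/permP=> -[v y].
  by rewrite !permE /shift /= mulg1 addr0.
move=> _ _ /imsetP[[u x] _ ->] /imsetP[[u' x'] _ ->].
apply/imsetP; exists ((u * u')%g, x + x') => //; apply/permP=> -[v y].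
by rewrite permM !permE /shift /= mulgA addrA.
Qed.

Canonical translations_group := Group translations_group_set.

Lemma sharply_transitive_translations : sharply_transitive translations_group.
Proof.
split.
  have -> : [set: T] = orbit 'P translations_group (1%g, 0).
    apply/esym/setP=> -[v y]; rewrite inE; apply/orbitP.
    exists (translation (v, y)); first exact: imset_f.
    by rewrite /= apermE permE /shift /= mul1g add0r.
  exact: atrans_orbit.
move=> [v y]; apply/trivgP/subsetP=> _ /setIP[/imsetP[[u x] _ ->] /astab1P].
rewrite /= apermE permE => -[vu yx]; apply/set1P/permP=> -[v' y'].
rewrite permE perm1 /shift /=; congr (_, _).
  by rewrite -[u](mulKg v) vu mulVg mulg1.
by rewrite -[x](addKr y) yx addNr addr0.
Qed.

Definition shift_index (u' : G) (o : option (I * F * G)) :=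
  if o is Some (i, s, u) then Some (i, s, (u * u')%g) else None.

Lemma imset_dblock u z x o :
  translation (u, z) @: dblock x o = dblock (x + z) (shift_index u o).
Proof.
apply/setP=> -[v y]; case: o => [[[i s] u']|] /=; last first.
  rewrite inE /=; apply/imsetP/eqP=> [[[v' y']]|->].
    by rewrite inE /= => /eqP -> ; rewrite permE => -[_ ->].
  by exists ((v * u^-1)%g, x); rewrite ?inE //= permE /shift /= mulgKV.
apply/imsetP/dblockP=> [[p /dblockP[j ji ->]]|[j ji ->]].
  by rewrite permE /shift /= => ->; exists j; rewrite // mulgA addrA.
exists ((b j * u')%g, a j * s + x); first by apply/dblockP; exists j.
by rewrite permE /shift /= mulgA addrA.
Qed.

Lemma setact_pclass u z x :
  ('P^*^*)%act (pclass x) (translation (u, z)) = pclass (x + z).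
Proof.
have ok o w : index_ok (shift_index w o) = index_ok o by case: o => [[[]]|].
rewrite /= /setact; apply/setP=> B.
apply/imsetP/imsetP=> [[_ /imsetP[o oko ->] ->]|[o oko ->]].
  exists (shift_index u o); last by rewrite -imset_dblock.
  by rewrite -[_ \in _]/(index_ok _) ok.
exists (dblock x (shift_index u^-1%g o)).
  by rewrite imset_f // -[_ \in _]/(index_ok _) ok.
rewrite [RHS]imset_dblock; congr dblock.
by case: o {oko} => [[[i s] u']|] //=; rewrite mulgKV.
Qed.

Lemma transitive_pclasses : [transitive translations_group, on pclasses | 'P^*^*].
Proof.
have -> : pclasses = orbit 'P^*^* translations_group (pclass 0).
  apply/setP=> P; apply/imsetP/orbitP => [[x _ ->]|[_ /imsetP[[u z] _ ->] <-]].
    exists (translation (1%g, x)); first exact: imset_f.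
    by rewrite setact_pclass add0r.
  by exists (0 + z); rewrite ?setact_pclass.
exact: atrans_orbit.
Qed.

Lemma automorphism_translation t :
  t \in translations_group -> automorphism dblocks t.
Proof.
move=> tA; apply/seq.permP=> r; rewrite count_map !count_dblocks.
(* A translation permutes the parallel classes, so the count may be compared class by class. *)
rewrite [RHS](reindex_inj (act_inj ('P^*^*)%act t)) /=.
have /acts_act actsP := atrans_acts transitive_pclasses.
apply: eq_big => [P|P _]; first by rewrite actsP.
rewrite -(card_imset _ (imset_inj (@perm_inj _ t))); apply: eq_card => B; rewrite inE.
apply/imsetP/andP=> [[B']|[/imsetP[B' B'P ->] rB]].
  by rewrite inE => /andP[B'P rB] ->; split=> //; apply: imset_f.
by exists B' => //; rewrite inE B'P.
Qed.

Lemma HS_of_labelling (K : seq nat) :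
  (forall n, n \in K <-> n = #|G| \/ exists i, #|block blk i| = n) ->
  HS_exists K (#|G| * #|F|).
Proof.
move=> KP; exists T, dblocks, pclasses, translations_group; split.
- split=> [|B /dblocksP[x [o [ok ->]]]|n /KP[->|[i <-]]|].
  + exact: card_prod.
  + rewrite card_dblock //; apply/KP.
    by case: o {ok} => [[[i s] u]|]; [right; exists i | left].
  + exists (dblock 0 None); last by rewrite card_dblock.
    by apply/dblocksP; exists 0, None.
  + have ok : index_ok (Some (i, 1, 1%g)) by rewrite /= oner_eq0 (cls1 clsP) eqxx.
    exists (dblock 0 (Some (i, 1, 1%g))); last by rewrite card_dblock.
    by apply/dblocksP; exists 0, (Some (i, 1, 1%g)).
  + exact: count_pair.
- by split=> [_ /imsetP[x _ ->]|]; [apply: pclass_partition | apply: perm_refl].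
- exact: automorphism_translation.
- exact: sharply_transitive_translations.
- exact: transitive_pclasses.
Qed.

End Design.

(** * From multisets of group elements to indexed positions *)

Section Positions.
Variables (G : finGroupType) (Sigma : seq (seq G)).

Local Notation B i := (nth [::] Sigma i).

(** Repeated blocks and repeated elements of a block give distinct positions. *)
Definition position : finType := {i : 'I_(size Sigma) & 'I_(size (B i))}.

Definition pos_block (j : position) : 'I_(size Sigma) := tag j.

Definition pos_elt (j : position) : G := nth 1%g (B (tag j)) (tagged j).

Lemma card_pos_block i : #|block pos_block i| = size (B i).
Proof.
pose I_ (i : 'I_(size Sigma)) := 'I_(size (B i)).
have inj : injective (fun x : I_ i => Tagged I_ x).
  by move=> x y /eqP; rewrite eq_Tagged => /eqP.
rewrite -[RHS]card_ord -(card_imset _ inj); apply: eq_card => -[i' x].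
rewrite inE /pos_block /=; apply/eqP/imsetP => [ii|[y _ /(congr1 tag)]//].
by subst i'; exists x.
Qed.

Lemma card_position : #|position| = \sum_(B <- Sigma) size B.
Proof.
rewrite card_tagged sumnE big_map big_enum /= (big_nth [::]) big_mkord.
by apply: eq_bigr => i _; rewrite card_ord.
Qed.

Lemma count_Delta x (s : seq G) :
  count_mem x (Delta s) =
  \sum_(i < size s) \sum_(j < size s)
    ((i != j :> nat) && (nth 1%g s i * (nth 1%g s j)^-1 == x)%g).
Proof.
rewrite /Delta count_map -sum1_count big_mkcond big_enum big_mkcond pair_bigA /=.
apply: eq_bigr => -[i j] _; rewrite !inE /= !(tnth_nth 1%g) /=.
by rewrite (inj_eq (@ord_inj _)); case: (i != j); case: (_ == x).
Qed.

Lemma position_strong_difference K lambda :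
  SDF K lambda Sigma -> #|position| = lambda -> strong_difference pos_block pos_elt.
Proof.
case=> _ _ dS pl x; rewrite pl -(dS x) count_flatten sumnE -map_comp big_map.
rewrite (big_nth [::]) big_mkord.
(* Taking [y] and [y'] as plain naturals avoids transporting an index from one block to another. *)
pose good (i : 'I_(size Sigma)) (y y' : nat) : nat :=
  (y != y') && (nth 1%g (B i) y * (nth 1%g (B i) y')^-1 == x)%g.
transitivity (\sum_(j : position) \sum_(j' : position)
    if tag j' == tag j then good (tag j) (tagged j) (tagged j') else 0).
  rewrite pair_bigA -sum1_card big_mkcond /=; apply: eq_bigr => -[[i y] [i' y']] _.
  rewrite !inE /= /pos_block /quot /pos_elt /= [i' == i]eq_sym.
  case: eqVneq => //= ii; subst i'.
  rewrite -tag_eqE /tag_eq /= eqxx /= tagged_asE /good val_eqE.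
  by case: (_ && _).
transitivity (\sum_(i < size Sigma) \sum_(y < size (B i)) \sum_(j' : position)
    if tag j' == i then good i y (tagged j') else 0).
  by rewrite [RHS]sig_big_dep /=; apply: eq_big => // -[i y].
apply: eq_bigr => i _; rewrite /= count_Delta; apply: eq_bigr => y _.
transitivity (\sum_(i' < size Sigma) \sum_(y' < size (B i'))
    if i' == i then good i y y' else 0).
  by rewrite [RHS]sig_big_dep /=; apply: eq_big => // -[i' y'].
rewrite (bigD1 i) //= eqxx [X in _ + X]big1 ?addn0 // => i' /negPf ->.
by rewrite big1.
Qed.

End Positions.

Theorem theorem5p3 (R : rcfType) (G : finGroupType) (g lambda : nat)
    (K' : seq nat) :
  #|G| = g ->
  (exists Sigma : seq (seq G), harmonious_SDF K' lambda Sigma) ->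
  forall q : nat,
    prime_power q ->
    q = lambda + 1 %[mod 2 * lambda] ->
    (Qbound R lambda (\max_(k <- K') k) < q%:R)%R ->
    HS_exists (undup (K' ++ [:: g])) (g * q).
Proof.
move=> <- [Sigma [sdfS sumS]] q [p [m [p_pr m0 qE]]] q_mod Qq.
have [size0 sizesS _] := sdfS.
have cardJ : #|position Sigma| = lambda by rewrite card_position.
have sdf := position_strong_difference sdfS cardJ.
have [F _ cardF] := pPrimePowerField p_pr m0.
rewrite -qE in cardF; rewrite -cardF in Qq q_mod *.
have q1 : 1 < #|F| by apply: finNzRing_gt1.
(* For [lambda = 0] the congruence is modulo 0 and would give [q = 1]. *)
have l0 : 0 < lambda.
  by rewrite lt0n; apply: contra_eq_neq q_mod => ->; rewrite muln0 !modn0; lia.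
have J0 : 0 < #|position Sigma| by rewrite cardJ.
have even_l : ~~ odd lambda by rewrite -cardJ; apply: even_card_positions sdf.
(* If [q = 2 * lambda * t + lambda + 1], then [f = 2 * t + 1]. An even positive [lambda] is at least
   2, so [lambda + 1] is a genuine remainder modulo [2 * lambda]. *)
have [f odd_f cardFf] : exists2 f, odd f & #|F| = (lambda * f).+1.
  have ll : lambda + 1 < 2 * lambda by lia.
  exists (2 * (#|F| %/ (2 * lambda)) + 1); first by rewrite oddD mul2n odd_double.
  rewrite [LHS](divn_eq _ (2 * lambda)) q_mod modn_small //; lia.
have memK n : n \in K' <-> exists i, #|block (@pos_block _ Sigma) i| = n.
  rewrite -(perm_mem sizesS); split=> [/mapP[B BS ->]|[i <-]]; last first.
    by rewrite card_pos_block map_f // mem_nth.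
  have Bi : index B Sigma < size Sigma by rewrite index_mem.
  by exists (Ordinal Bi); rewrite card_pos_block /= nth_index.
pose k := \max_(k <- K') k.
have block_le i : #|block (@pos_block _ Sigma) i| <= k.
  by rewrite /k; apply: (leq_bigmax_seq (F := id)) => //; apply/memK; exists i.
have block_k : exists i, #|block (@pos_block _ Sigma) i| = k.
  apply/memK; rewrite /k.
  (* The maximum is attained only over a nonempty list; over the empty one it defaults to 0. *)
  have K0 : K' != [::].
    apply: contraTneq J0 => K0; rewrite cardJ -sumS; move: sizesS; rewrite K0.
    by move/perm_size; rewrite size_map => /size0nil ->; rewrite big_nil.
  case: K' K0 {memK block_le sizesS Qq sdfS k} => // n s _.
  elim: s n => [|n' s IH] n; first by rewrite big_seq1 mem_head.
  by rewrite big_cons; case: leqP => _; rewrite ?mem_head // inE IH orbT.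
have f0 : 0 < f by case: f odd_f {cardFf}.
rewrite -cardJ in even_l cardFf Qq l0 *.
have J1 : 1 < #|position Sigma| by lia.
have [cls clsP] := class_map_exists J1 even_l odd_f cardFf.
have [a aP] := labelling_exists sdf J0 block_le block_k clsP f0 cardFf Qq.
have onto i : exists j, @pos_block _ Sigma j = i.
  have /card_gt0P[j] : 0 < #|block (@pos_block _ Sigma) i|.
    by rewrite card_pos_block; apply: (allP size0); rewrite mem_nth.
  by rewrite inE => /eqP; exists j.
apply: (HS_of_labelling sdf J1 clsP aP onto) => n.
rewrite mem_undup mem_cat mem_seq1; split.
  by case/orP=> [/memK|/eqP ->]; [right | left].
by case=> [->|/memK ->]; rewrite ?eqxx ?orbT.
Qed.
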